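(* Assume (A1), (A2), and that $\{\gamma_n\}_{n\ge1}$ is a deterministic $[0,1)$-valued non-increasing sequence with $\lim_n\gamma_n=0$. Then for the linearized Wang–Landau algorithm, $$\mathbb P\Big(\limsup_{n\to\infty}\underline\theta_n>0\Big)=1,\qquad\text{where }\underline\theta_n=\min_{1\le j\le d}\theta_n(j).$$
   Context: Let $(\mathsf X,\mathcal X)$ be a Polish space with its Borel $\sigma$-algebra, endowed with a $\sigma$-finite reference measure $\lambda$, and let $\pi$ be a probability density with respect to $\lambda$. Let $d\ge 2$ and let $\mathsf X_1,\dots,\mathsf X_d$ be a measurable partition of $\mathsf X$; let $I:\mathsf X\to\{1,\dots,d\}$ be defined by $I(x)=i$ iff $x\in\mathsf X_i$. Set $\theta_\star(i)=\int_{\mathsf X_i}\pi\,d\lambda$. Let $\Theta=\{\theta\in(0,1)^d:\sum_i\theta(i)=1\}$. For $\theta\in\Theta$, $\pi_\theta(x)=\big(\sum_{i}\theta_\star(i)/\theta(i)\big)^{-1}\sum_{i}\frac{\pi(x)}{\theta(i)}\mathbf 1_{\mathsf X_i}(x)$. (A1): $0<\inf_{\mathsf X}\pi\le\sup_{\mathsf X}\pi<\infty$ and $\min_i\theta_\star(i)>0$. (A2): for each $\theta\in\Theta$, $P_\theta$ is the Metropolis–Hastings kernel with target $\pi_\theta\,d\lambda$ and symmetric proposal density $q(x,y)$ w.r.t. $\lambda$ with $\inf_{\mathsf X^2}q>0$, acceptance probability $\alpha_\theta(x,y)=1\wedge(\pi_\theta(y)/\pi_\theta(x))$. Linearized Wang–Landau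 algorithm: given $X_0\in\mathsf X$, $\theta_0\in\Theta$ and step sizes $\gamma_n\in[0,1)$, for $n\ge0$ draw $X_{n+1}$ from $P_{\theta_n}(X_n,\cdot)$ conditionally on $\mathcal F_n=\sigma(\theta_0,X_0,\dots,X_n)$, and set $\theta_{n+1}=\theta_n+\gamma_{n+1}H(X_{n+1},\theta_n)$ where $H_i(x,\theta)=\theta(i)\big(\mathbf 1_{\mathsf X_i}(x)-\theta(I(x))\big)$. (Equivalently, with $i=I(X_{n+1})$: $\theta_{n+1}(i)=\theta_n(i)+\gamma_{n+1}\theta_n(i)(1-\theta_n(i))$ and $\theta_{n+1}(k)=\theta_n(k)-\gamma_{n+1}\theta_n(k)\theta_n(i)$ for $k\ne i$.) Then $\theta_n\in\Theta$ for all $n$. *)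

(* Defs.v *)
From HB Require Import structures.
From mathcomp Require Import all_boot all_order all_algebra.
From mathcomp Require Import all_classical all_reals all_analysis.
Set Implicit Arguments. Unset Strict Implicit. Unset Printing Implicit Defensive.
Import Order.TTheory GRing.Theory Num.Theory.
Import numFieldNormedType.Exports.
Local Open Scope classical_set_scope.
Local Open Scope ring_scope.

Definition is_metric {R : realType} {X : Type} (dist : X -> X -> R) :=
  [/\ forall x y, dist x y = 0 <-> x = y,
      forall x y, dist x y = dist y x &
      forall x y z, dist x z <= dist x y + dist y z].

Definition metric_complete {R : realType} {X : Type} (dist : X -> X -> R) :=
  forall u : nat -> X,
    (forall e, 0 < e -> exists N, forall m n, (N <= m)%N -> (N <= n)%N ->
       dist (u m) (u n) < e) ->
    exists l, forall e, 0 < e -> exists N, forall n, (N <= n)%N -> dist (u n) l < e.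

Definition metric_separable {R : realType} {X : Type} (dist : X -> X -> R) :=
  exists D : set X, countable D /\
    forall x e, 0 < e -> exists2 y, D y & dist x y < e.

Definition metric_open {R : realType} {X : Type} (dist : X -> X -> R) (O : set X) :=
  forall x, O x -> exists2 e, 0 < e & [set y | dist x y < e] `<=` O.

Definition polish_borel {R : realType} {dX} (X : measurableType dX) :=
  exists dist : X -> X -> R,
    [/\ is_metric dist, metric_complete dist, metric_separable dist &
        (@measurable dX X : set (set X)) =
          smallest (sigma_algebra setT) (metric_open dist)].

Section WL.
Context {R : realType} {dX} {X : measurableType dX} {d : nat}.
Variables (lam : {measure set X -> \bar R}) (pi : X -> R) (I : X -> 'I_d)
          (q : X -> X -> R).

Definition cell (i : 'I_d) : set X := I @^-1` [set i].

Definition theta_star (i : 'I_d) : R := fine (\int[lam]_(x in cell i) (pi x)%:E).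

Definition Theta (th : 'I_d -> R) : Prop :=
  (forall i, 0 < th i < 1) /\ \sum_i th i = 1.

Definition pi_theta (th : 'I_d -> R) (x : X) : R :=
  (\sum_i theta_star i / th i)^-1 *
  \sum_i (pi x / th i) * \1_(cell i) x.

Definition alpha (th : 'I_d -> R) (x y : X) : R :=
  Num.min 1 (pi_theta th y / pi_theta th x).

Definition mh_kernel (th : 'I_d -> R) (x : X) (A : set X) : \bar R :=
  (\int[lam]_(y in A) (q x y * alpha th x y)%:E
   + (\1_A x)%:E * (1 - \int[lam]_y (q x y * alpha th x y)%:E))%E.

Definition H (x : X) (th : 'I_d -> R) (i : 'I_d) : R :=
  th i * (\1_(cell i) x - th (I x)).

End WL.

(* The pair of processes (X_n, theta_n) on (Omega, P) is a run of the
   linearized Wang--Landau algorithm with step sizes gamma. The conditional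
   law statement "X_{n+1} ~ P_{theta_n}(X_n, .) given F_n" is expressed on the
   pi-system of generating events of F_n = sigma(theta_0, X_0, ..., X_n). *)
Definition linearized_WL {R : realType} {dX dO} {X : measurableType dX}
    {Omega : measurableType dO} {d : nat}
    (lam : {measure set X -> \bar R}) (pi : X -> R) (I : X -> 'I_d)
    (q : X -> X -> R) (gamma : nat -> R) (P : probability Omega R)
    (Xs : nat -> Omega -> X) (th : nat -> Omega -> 'I_d -> R) : Prop :=
  [/\ forall n, measurable_fun setT (Xs n),
      forall i, measurable_fun setT (fun w => th 0%N w i),
      forall w, Theta (th 0%N w),
      forall n w i, th n.+1 w i =
                    th n w i + gamma n.+1 * H I (Xs n.+1 w) (th n w) i &
      forall n (B : 'I_d -> set R) (A : nat -> set X) (C : set X),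
        (forall i, measurable (B i)) -> (forall k, measurable (A k)) ->
        measurable C ->
        let E := [set w | (forall i, B i (th 0%N w i)) /\
                          (forall k, (k <= n)%N -> A k (Xs k w))] in
        P (E `&` (Xs n.+1 @^-1` C)) =
        (\int[P]_(w in E) mh_kernel lam pi I q (th n w) (Xs n w) C)%E].

(* Main.v *)
(* From any state the stratum of smallest weight is proposed with probability
   bounded below and accepted with probability at least inf pi / sup pi, while a
   stratum of weight u times larger is entered with probability O(1/u).  Hence,
   for a small exponent s, the function x |-> theta(I(x))^s is contracted by
   P_theta up to the additive error (min theta)^s.  On the other hand the
   relative conditional drift of F(theta) = sum_i 1/theta(i) is at most gamma
   times E[theta(I(X))] minus a positive constant, up to O(gamma^2); the first
   term is compensated by the contraction, so that
     W_n = F(theta_n) * (1 + a * gamma_n * theta_n(I(X_n))^s)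
   has nonpositive conditional drift whenever gamma_n is small and
   min theta_n <= eta.  On the event that min theta_n stays below eta from some
   time on, Fatou's lemma forbids W_n -> oo, hence forbids min theta_n -> 0. *)

Require Import Defs.
From HB Require Import structures.
From mathcomp Require Import all_boot all_order all_algebra.
From mathcomp Require Import all_classical all_reals all_analysis.
From mathcomp Require Import measurable_realfun ring lra.
Set Implicit Arguments. Unset Strict Implicit. Unset Printing Implicit Defensive.
Import Order.TTheory GRing.Theory Num.Theory.
Import numFieldNormedType.Exports.
Local Open Scope classical_set_scope.
Local Open Scope ring_scope.

(** * Concavity of powers with exponent below one *)

(** Young's inequality for the product of [u^s] and [1], with conjugate exponents [1/s] and
    [1/(1-s)]. *)
Lemma powR_le_tangent1 (R : realType) (s u : R) :
  0 < s < 1 -> 0 <= u -> u `^ s <= 1 + s * (u - 1).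
Proof.
move=> /andP[s0 s1] u0.
have h : s^-1^-1 + ((1 - s)^-1)^-1 = 1 by rewrite !invrK; ring.
have := conjugate_powR (powR_ge0 u s) (@ler01 R) (p := s^-1) (q := (1 - s)^-1).
rewrite !invr_gt0 subr_gt0 s0 s1 => /(_ isT isT h).
rewrite -powRrM mulfV ?gt_eqF// powRr1// powR1 !invrK mulr1 => /le_trans; apply.
lra.
Qed.

(** * Drift of the Lyapunov function *)

Section Update.
Variables (R : realType) (d : nat).
Implicit Types (th : 'I_d -> R) (i j : 'I_d).

(** The update sees the new point only through its stratum [i]; indexing by [i] turns conditional
    expectations into finite sums over strata. *)
Definition wl_update (g : R) th i : 'I_d -> R :=
  fun j => th j + g * (th j * ((i == j)%:R - th i)).

Definition sum_inv th : R := \sum_i (th i)^-1.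

(** W_n is [lyapunov s a (gamma n) (th n w) (I (Xs n w))]. The second factor is a corrector, larger
    while a heavy stratum is occupied. *)
Definition lyapunov (s a g : R) th i : R :=
  sum_inv th * (1 + a * g * th i `^ s).

(** Coordinate [j] is multiplied by [1 + g * ((i == j) - th i)], positive since [g * th i < 1], and
    the total mass is preserved. A second stratum of positive weight keeps every weight below
    [1]. *)
Lemma wl_update_Theta g th i :
  0 <= g < 1 -> (1 < d)%N -> Theta th -> Theta (wl_update g th i).
Proof.
move=> /andP[g0 g1] d1 [h1 hs].
have hpos j : 0 < wl_update g th i j.
  have /andP[j0 j1] := h1 j; have /andP[i0 i1] := h1 i.
  rewrite /wl_update -[X in X + _]mulr1 mulrCA -mulrDr mulr_gt0//.
  have gi : g * th i < 1 by nra.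
  have : 0 <= g * (i == j)%:R by rewrite mulr_ge0.
  lra.
have hsum : \sum_j wl_update g th i j = 1.
  rewrite big_split/= hs -mulr_sumr.
  rewrite (eq_bigr (fun j => th j * (i == j)%:R - th i * th j)); last first.
    by move=> j _; ring.
  rewrite sumrB -mulr_sumr hs (bigD1 i)//= eqxx big1; last first.
    by move=> j /negbTE; rewrite eq_sym => ->; rewrite mulr0.
  by rewrite !mulr1 addr0 subrr mulr0 addr0.
split=> // j; rewrite hpos/= -hsum (bigD1 j)//= ltrDl.
have [k kj] : exists k : 'I_d, k != j.
  case: d d1 j {th h1 hs i hpos hsum} => [//|[//|n]] _ j.
  by exists (lift j ord0); rewrite eq_sym neq_lift.
rewrite (bigD1 k)//= ltr_pwDl ?hpos// sumr_ge0// => l _; exact/ltW/hpos.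
Qed.

Lemma sum_inv_gt0 th i : (forall j, 0 < th j) -> 0 < sum_inv th.
Proof.
move=> h; rewrite /sum_inv (bigD1 i)//= ltr_pwDl ?invr_gt0// sumr_ge0// => j _.
by rewrite invr_ge0 ltW.
Qed.

Lemma sum_inv_ge th i : (forall j, 0 < th j) -> (th i)^-1 <= sum_inv th.
Proof.
move=> h; rewrite /sum_inv (bigD1 i)//= lerDl sumr_ge0// => j _.
by rewrite invr_ge0 ltW.
Qed.

Lemma sum_inv_le_min th i0 : (forall j, 0 < th j) ->
  (forall j, th i0 <= th j) -> sum_inv th <= d%:R / th i0.
Proof.
move=> h hm; rewrite /sum_inv.
apply: (@le_trans _ _ (\sum_(i < d) (th i0)^-1)).
  by apply: ler_sum => i _; rewrite lef_pV2 ?posrE.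
by rewrite sumr_const card_ord mulr_natl.
Qed.

(** Each coordinate is multiplied by some [1 + x] with [|x| <= g <= 1/2], and then
    [1/(1+x) <= 1 - x + 2 * g^2]. The gain [- g / th i] comes from the visited stratum alone. *)
Lemma sum_inv_update g th i : 0 <= g <= 2^-1 -> Theta th ->
  sum_inv (wl_update g th i) <=
    sum_inv th * (1 + g * th i + 2 * g ^+ 2) - g / th i.
Proof.
move=> /andP[g0 g1] [h1 hs].
have key j : (wl_update g th i j)^-1 <=
    (th j)^-1 * (1 + g * th i + 2 * g ^+ 2) - (i == j)%:R * g / th j.
  have /andP[j0 j1] := h1 j; have /andP[i0 i1] := h1 i.
  set b : R := (i == j)%:R.
  have /andP[b0 b1] : 0 <= b <= 1 by rewrite /b; case: (i == j); rewrite ?lexx ?ler01.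
  set x := g * (b - th i).
  have -> : wl_update g th i j = th j * (1 + x).
    by rewrite /wl_update -/b /x; ring.
  have -> : (th j)^-1 * (1 + g * th i + 2 * g ^+ 2) - b * g / th j =
    (th j)^-1 * (1 - x + 2 * g ^+ 2).
    by rewrite /x; ring.
  rewrite invfM ler_pM2l ?invr_gt0//.
  have x1 : x <= g by rewrite /x; nra.
  have x2 : - g <= x by rewrite /x; nra.
  have x0 : 0 < 1 + x by lra.
  rewrite -div1r ler_pdivrMr//.
  have xg : x ^+ 2 <= g ^+ 2 by nra.
  nra.
apply: (le_trans (ler_sum _ (fun j _ => key j))).
rewrite sumrB -mulr_suml -/(sum_inv th) (bigD1 i)//= eqxx big1; last first.
  by move=> j /negbTE; rewrite eq_sym => ->; rewrite !mul0r.
by rewrite mul1r addr0.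
Qed.

(** Product of the bounds on the two factors. Since [th i <= (th i)^s], the first-order increase of
    [sum_inv] and the corrector merge into one term with coefficient [1 + a]. *)
Lemma lyapunov_update (s a g : R) th i : 0 < s < 1 -> 0 <= a ->
  0 <= g <= 2^-1 -> Theta th ->
  lyapunov s a g (wl_update g th i) i <=
    sum_inv th * (1 + (2 + 7 * a) * g ^+ 2) +
    (1 + a) * g * sum_inv th * th i `^ s - g / th i.
Proof.
move=> s01 a0 g01 Hth.
have /andP[s0 s1] := s01; have /andP[g0 g1] := g01.
have F1 := sum_inv_update i g01 Hth.
case: Hth => h1 hs.
have /andP[i0 i1] := h1 i.
have ti : th i <= th i `^ s.
  by apply: ger1_powR; [rewrite i0 ltW|exact: ltW].
set f := th i `^ s in ti *.
have f0 : 0 <= f by exact: powR_ge0.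
have f1 : f <= 1.
  rewrite /f -(powRr0 (th i)); apply: ger_powR; last exact: ltW.
  by rewrite i0 ltW.
(* The visited weight grows by a factor at most [1 + g], and by the tangent bound so does its power
   [s]. *)
have f' : wl_update g th i i `^ s <= f * (1 + g).
  have -> : wl_update g th i i = th i * (1 + g * (1 - th i)).
    by rewrite /wl_update eqxx /=; ring.
  have u0 : 0 <= 1 + g * (1 - th i) by nra.
  rewrite powRM//; last exact: ltW.
  rewrite ler_pM2l ?powR_gt0//.
  apply: (le_trans (powR_le_tangent1 _ _)) => //.
  have : g * (1 - th i) <= g by nra.
  move: u0; set y := g * (1 - th i) => u0 yg.
  have : 0 <= y by apply: mulr_ge0 => //; lra.
  nra.
set F' := sum_inv (wl_update _ _ _) in F1 *.
have F0 : 0 <= sum_inv th by rewrite sumr_ge0// => j _; rewrite invr_ge0; case/andP: (h1 j) => /ltW.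
have F'0 : 0 <= F'.
  apply: sumr_ge0 => j _; rewrite invr_ge0.
  have /andP[j0 j1] := h1 j.
  have -> : wl_update g th i j = th j * (1 + g * ((i == j)%:R - th i)).
    by rewrite /wl_update; ring.
  apply: mulr_ge0; first exact: ltW.
  have gi : g * th i <= 1 by nra.
  have : 0 <= g * (i == j)%:R by rewrite mulr_ge0.
  lra.
set F := sum_inv th in F1 F0 *.
set v := g / th i in F1 *.
have v0 : 0 <= v by rewrite /v divr_ge0// ltW.
have ag : 0 <= a * g by nra.
have e1 : 1 + a * g * wl_update g th i i `^ s <= 1 + a * g * f + a * g ^+ 2.
  rewrite -addrA lerD2l; apply: (@le_trans _ _ (a * g * (f * (1 + g)))).
    exact: ler_wpM2l.
  have : a * g * (g * f) <= a * g * (g * 1) by rewrite ler_wpM2l// ler_wpM2l.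
  nra.
set y := a * g * f + a * g ^+ 2.
have y0 : 0 <= y by rewrite /y; apply: addr_ge0; apply: mulr_ge0 => //; exact: sqr_ge0.
have b1 : F' <= F * (1 + g * f + 2 * g ^+ 2) - v.
  apply: (le_trans F1); rewrite lerD2r ler_wpM2l// lerD2r lerD2l.
  exact: ler_wpM2l.
rewrite /lyapunov -/F'.
apply: (@le_trans _ _ (F' * (1 + y))).
  by apply: ler_wpM2l => //; rewrite /y addrA.
apply: (@le_trans _ _ ((F * (1 + g * f + 2 * g ^+ 2) - v) * (1 + y))).
  by apply: ler_wpM2r => //; lra.
(* The [g^2] coefficient is [2] plus multiples of [a] with weights 1, 1, 1, 2, 2; bounding products
   of [f] and [g] by [1] gives [2 + 7 * a]. *)
have e2 : (1 + g * f + 2 * g ^+ 2) * (1 + y) <=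
    1 + (1 + a) * g * f + (2 + 7 * a) * g ^+ 2.
  have -> : (1 + g * f + 2 * g ^+ 2) * (1 + y) =
     1 + (1 + a) * g * f + g ^+ 2 *
       (2 + a + a * f * f + a * (g * f) + 2 * a * (g * f) + 2 * a * (g * g)).
    by rewrite /y; ring.
  rewrite lerD2l mulrC ler_wpM2r ?sqr_ge0//.
  have ff : f * f <= 1 by nra.
  have gf : g * f <= 1 by nra.
  have gg : g * g <= 1 by nra.
  have := ler_wpM2l a0 ff; have := ler_wpM2l a0 gf; have := ler_wpM2l a0 gg.
  lra.
have := ler_wpM2l F0 e2; have : 0 <= v * y by exact: mulr_ge0.
nra.
Qed.

(** Here [k] plays the law of the next stratum from stratum [j], and [i0] is a lightest stratum. The
    gain [g * \sum_i k i / th i] is at least [g * eps * F / d]; one half absorbs the [g^2] error,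
    the other the additive error [(th i0)^s] of the contraction. *)
Lemma lyapunov_drift (s kap eps g g0 : R) th (k : 'I_d -> R) i0 j :
  let a := kap^-1 in
  0 < s < 1 -> 0 < kap -> 0 < eps ->
  0 <= g <= 2^-1 -> g <= g0 -> Theta th ->
  (forall i, 0 <= k i) -> \sum_i k i = 1 ->
  (forall i, th i0 <= th i) -> eps <= k i0 ->
  \sum_i k i * th i `^ s <= (1 - kap) * th j `^ s + th i0 `^ s ->
  (2 + 7 * a) * g <= eps / (2 * d%:R) ->
  (1 + a) * th i0 `^ s <= eps / (2 * d%:R) ->
  \sum_i k i * lyapunov s a g (wl_update g th i) i <= lyapunov s a g0 th j.
Proof.
move=> a s01 kap0 eps0 g01 gg0 Hth k0 k1 hmin ki0 hphi hg hth.
have a0 : 0 <= a by rewrite invr_ge0 ltW.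
have aK : a * kap = 1 by rewrite /a mulVf// gt_eqF.
have /andP[gge gle] := g01.
have hp l : 0 < th l by case: Hth => h _; case/andP: (h l).
have d0 : 0 < d%:R :> R by rewrite ltr0n (leq_trans _ (ltn_ord i0)).
set F := sum_inv th.
have F0 : 0 < F by exact: sum_inv_gt0.
have Fd : F / d%:R <= (th i0)^-1.
  by rewrite ler_pdivrMr// mulrC; exact: sum_inv_le_min.
apply: (@le_trans _ _ (\sum_i k i * (F * (1 + (2 + 7 * a) * g ^+ 2) +
    (1 + a) * g * F * th i `^ s - g / th i))).
  apply: ler_sum => i _; apply: ler_wpM2l => //; exact: lyapunov_update.
rewrite (eq_bigr (fun i => k i * (F * (1 + (2 + 7 * a) * g ^+ 2)) +
    (1 + a) * g * F * (k i * th i `^ s) - g * (k i / th i))); last first.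
  by move=> i _; ring.
rewrite sumrB big_split/= -mulr_suml -!mulr_sumr k1 mul1r.
have S1 : eps * (F / d%:R) <= \sum_i k i / th i.
  apply: (@le_trans _ _ (k i0 / th i0)).
    by apply: ler_pM => //; [exact: ltW|rewrite divr_ge0// ltW].
  rewrite (bigD1 i0)//= lerDl sumr_ge0// => i _; rewrite divr_ge0//; exact: ltW.
set S := \sum_i _ in S1 *; set T := \sum_i _ in hphi *.
rewrite /lyapunov -/F.
set f := th j `^ s in hphi *; set m := th i0 `^ s in hphi hth *.
have f0 : 0 <= f by exact: powR_ge0.
have gF : 0 <= g * F by apply: mulr_ge0 => //; exact: ltW.
have h1 : (1 + a) * (g * F) * T <= (g * F) * (a * f) + (g * F) * (eps / (2 * d%:R)).
  apply: (@le_trans _ _ ((g * F) * ((1 + a) * ((1 - kap) * f + m)))).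
    rewrite mulrAC mulrC ler_wpM2l//; apply: ler_wpM2l => //; lra.
  rewrite -mulrDr ler_wpM2l// mulrDr lerD// mulrA ler_wpM2r//.
  (* The choice [a = 1/kap] makes this [1 + a - kap - 1 <= a], so the old corrector pays for both
     the new one and the drift of [F]. *)
  have -> : (1 + a) * (1 - kap) = 1 + a - kap - a * kap by ring.
  rewrite aK; lra.
have h2 : F * ((2 + 7 * a) * g ^+ 2) <= (g * F) * (eps / (2 * d%:R)).
  have -> : F * ((2 + 7 * a) * g ^+ 2) = (g * F) * ((2 + 7 * a) * g) by ring.
  exact: ler_wpM2l.
have h3 : g * (eps * (F / d%:R)) <= g * S by exact: ler_wpM2l.
have h4 : g * (eps * (F / d%:R)) = 2 * ((g * F) * (eps / (2 * d%:R))).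
  by field; rewrite gt_eqF.
(* Monotonicity of the steps enters here: the old corrector carries the larger step [g0]. *)
have h5 : (g * F) * (a * f) <= F * (a * g0 * f).
  have -> : F * (a * g0 * f) = g0 * (F * (a * f)) by ring.
  have -> : g * F * (a * f) = g * (F * (a * f)) by ring.
  apply: ler_wpM2r => //; apply: mulr_ge0; [exact: ltW|exact: mulr_ge0].
rewrite -(mulrA (1 + a)) in h1.
rewrite -!(mulrA (1 + a)) !mulrDr !mulr1.
rewrite mulrA; lra.
Qed.

End Update.

(** * Metropolis-Hastings transition probabilities between strata *)

Lemma measurable_fun_invr d (T : measurableType d) (R : realType) (f : T -> R) :
  (forall t, 0 <= f t) -> measurable_fun setT f ->
  measurable_fun setT (fun t => (f t)^-1).
Proof.
move=> f0 mf; rewrite (_ : (fun t => _) = (fun x => x `^ (-1)) \o f).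
  by apply: measurableT_comp => //; exact: measurable_powR.
by apply/funext => t /=; rewrite powR_inv1.
Qed.

(* [a i] and [b i] stand for the accepted and the proposed mass of stratum [i]
   when the chain sits in stratum [j]; [D] bounds the oscillation of [pi]. *)
Lemma mh_contraction (R : realType) (d : nat) (a b th : 'I_d -> R) (D eps s : R)
    (i0 j : 'I_d) :
  (forall i, 0 < th i) -> (forall i, th i0 <= th i) ->
  (forall i, 0 <= a i <= b i) -> \sum_i b i = 1 ->
  (forall i, a i <= b i * (D * th j / th i)) -> 0 <= D -> eps <= a i0 ->
  0 < s < 1 ->
  \sum_i (a i + (i == j)%:R * (1 - \sum_l a l)) * th i `^ s <=
    (1 - (eps - D * s)) * th j `^ s + th i0 `^ s.
Proof.
move=> th0 hmin ab b1 aD D0 epsa s01.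
have /andP[s0 s1] := s01.
have b0 i : 0 <= b i by have /andP[/le_trans h /h] := ab i.
set r := th j `^ s.
have r0 : 0 <= r by exact: powR_ge0.
(* Rejected mass stays in stratum [j], so only accepted moves change the value [r]. *)
have -> : \sum_i (a i + (i == j)%:R * (1 - \sum_l a l)) * th i `^ s =
    r + \sum_i a i * (th i `^ s - r).
  rewrite (eq_bigr (fun i => a i * th i `^ s +
    (i == j)%:R * ((1 - \sum_l a l) * th i `^ s))); last by move=> i _; ring.
  rewrite big_split/= [X in _ + X](bigD1 j)//= eqxx [X in _ + (_ + X)]big1.
    rewrite [in RHS](eq_bigr (fun i => a i * th i `^ s - a i * r)); last first.
      by move=> i _; ring.
    by rewrite sumrB -mulr_suml -/r mul1r addr0; ring.
  by move=> i /negbTE ->; rewrite mul0r.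
(* A move to a stratum no heavier contributes at most zero. To a stratum [u >= 1] times heavier, the
   increase is at most [r * s * (u - 1)] and the accepted mass at most [b i * D / u]. *)
have gen i : a i * (th i `^ s - r) <= b i * (D * s * r).
  have DsR : 0 <= D * s * r by rewrite !mulr_ge0// ltW.
  have /andP[ai0 aib] := ab i.
  have [le|/ltW le] := leP (th i) (th j).
    apply: (@le_trans _ _ 0); last exact: mulr_ge0.
    rewrite mulr_ge0_le0// subr_le0.
    by apply: ge0_ler_powR => //; rewrite ?nnegrE ?ltW.
  set u := th i / th j.
  have thE : th i = th j * u by rewrite /u mulrC divfK// gt_eqF.
  have u1 : 1 <= u by rewrite /u ler_pdivlMr// mul1r.
  have u0 : 0 <= u by lra.
  have H1 : th i `^ s - r <= r * (s * (u - 1)).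
    rewrite thE powRM//; last exact: ltW.
    rewrite -/r.
    have := ler_wpM2l r0 (powR_le_tangent1 s01 u0).
    lra.
  have Q0 : 0 <= r * (s * (u - 1)) by rewrite !mulr_ge0 ?subr_ge0// ltW.
  apply: (@le_trans _ _ (a i * (r * (s * (u - 1))))); first exact: ler_wpM2l.
  apply: (@le_trans _ _ (b i * (D * th j / th i) * (r * (s * (u - 1))))).
    exact: ler_wpM2r.
  rewrite -mulrA; apply: ler_wpM2l => //.
  have -> : D * th j / th i = D * u^-1.
    by rewrite /u invfM invrK; ring.
  have -> : D * u^-1 * (r * (s * (u - 1))) = D * s * r * (u^-1 * (u - 1)) by ring.
  rewrite -[leRHS]mulr1; apply: ler_wpM2l => //.
  rewrite mulrBr mulVf ?mulr1 ?gerBl ?invr_ge0// gt_eqF//; lra.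
have i0b : a i0 * (th i0 `^ s - r) <= th i0 `^ s - eps * r.
  have /andP[a0 ab0] := ab i0.
  have bi0 : b i0 <= 1.
    by rewrite -b1 (bigD1 i0)//= lerDl sumr_ge0.
  have m0 : 0 <= th i0 `^ s by exact: powR_ge0.
  rewrite mulrBr lerB//; last exact: ler_wpM2r.
  by rewrite -[leRHS]mul1r ler_wpM2r// (le_trans ab0).
have DsR : 0 <= D * s * r by rewrite !mulr_ge0// ltW.
have S : \sum_(i | i != i0) a i * (th i `^ s - r) <= D * s * r.
  apply: (@le_trans _ _ (\sum_(i | i != i0) b i * (D * s * r))).
    by apply: ler_sum => i _; exact: gen.
  rewrite -mulr_suml -[leRHS]mul1r ler_wpM2r// -b1 [leRHS](bigD1 i0)//=.
  by rewrite lerDr.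
rewrite (bigD1 i0)//=; lra.
Qed.

(** * Acceptance probabilities and stratum masses of the kernel *)

Section Kernel.
Context (R : realType) (dX : measure_display) (X : measurableType dX) (d : nat).
Variables (lam : {measure set X -> \bar R}) (pi : X -> R) (I : X -> 'I_d).
Variable (q : X -> X -> R).
Hypothesis mpi : measurable_fun setT pi.
Hypothesis mcell : forall i, measurable (cell I i).
Variables (c C cq : R).
Hypotheses (c0 : 0 < c) (cpi : forall x, c <= pi x) (piC : forall x, pi x <= C).
Hypothesis theta_star0 : forall i, 0 < theta_star lam pi I i.
Hypothesis mq : measurable_fun setT (fun z : X * X => q z.1 z.2).
Hypothesis q1 : forall x, (\int[lam]_y (q x y)%:E = 1)%E.
Hypotheses (cq0 : 0 < cq) (cqq : forall x y, cq <= q x y).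

Let pi0 x : 0 < pi x. Proof. exact: lt_le_trans (cpi x). Qed.
Let C0 (x : X) : 0 < C. Proof. exact: lt_le_trans (pi0 x) (piC x). Qed.
Let q0 x y : 0 <= q x y. Proof. exact: le_trans (ltW cq0) (cqq x y). Qed.

Lemma cell_indic i x : \1_(cell I i) x = (I x == i)%:R :> R.
Proof.
rewrite indicE; congr (_ %:R); congr nat_of_bool; apply/idP/eqP.
  by rewrite inE.
by move=> h; rewrite inE.
Qed.

Lemma pi_thetaE (th : 'I_d -> R) x : pi_theta lam pi I th x =
  (\sum_i theta_star lam pi I i / th i)^-1 * (pi x / th (I x)).
Proof.
rewrite /pi_theta; congr (_ * _); under eq_bigr do rewrite cell_indic.
rewrite (bigD1 (I x))//= eqxx mulr1 big1 ?addr0// => i.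
by rewrite eq_sym => /negbTE ->; rewrite mulr0.
Qed.

(** The normalizing sum is positive and cancels in the ratio. *)
Lemma alphaE th x y : Theta th ->
  alpha lam pi I th x y = Num.min 1 (pi y / pi x * (th (I x) / th (I y))).
Proof.
move=> [h _]; rewrite /alpha !pi_thetaE; congr Num.min.
have th0 i : 0 < th i by case/andP: (h i).
set Z := \sum_i _.
have Z0 : 0 < Z.
  rewrite /Z (bigD1 (I x))//= ltr_pwDl ?divr_gt0// sumr_ge0// => i _.
  by rewrite divr_ge0// ltW.
by field; rewrite !gt_eqF.
Qed.

Lemma alpha_ge0_le1 th x y : Theta th -> 0 <= alpha lam pi I th x y <= 1.
Proof.
move=> hth; rewrite alphaE// ge_min lexx/= andbT le_min ler01/=.
have th0 i : 0 <= th i by case: hth => h _; case/andP: (h i) => /ltW.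
by rewrite mulr_ge0// divr_ge0// ltW.
Qed.

(** [I] is measurable through its cells, so the value is expanded over the cell indicators. *)
Lemma measurable_theta_I dT (T : measurableType dT) (th : T -> 'I_d -> R) (x : T -> X) :
  (forall i, measurable_fun setT (fun t => th t i)) -> measurable_fun setT x ->
  measurable_fun setT (fun t => th t (I (x t))).
Proof.
move=> mth mx.
rewrite (_ : (fun t => _) = fun t => \sum_i th t i * \1_(cell I i) (x t)).
  apply: measurable_sum => i; apply: measurable_funM => //.
  exact: measurableT_comp (measurable_indic (mcell i)) mx.
apply/funext => t; under eq_bigr do rewrite cell_indic.
rewrite (bigD1 (I (x t)))//= eqxx mulr1 big1 ?addr0//.
by move=> i; rewrite eq_sym => /negbTE ->; rewrite mulr0.
Qed.

Lemma measurable_alpha dT (T : measurableType dT) (th : T -> 'I_d -> R)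
    (x y : T -> X) :
  (forall t, Theta (th t)) -> (forall i, measurable_fun setT (fun t => th t i)) ->
  measurable_fun setT x -> measurable_fun setT y ->
  measurable_fun setT (fun t => alpha lam pi I (th t) (x t) (y t)).
Proof.
move=> hth mth mx my.
rewrite (_ : (fun t => _) = fun t =>
    Num.min 1 (pi (y t) / pi (x t) * (th t (I (x t)) / th t (I (y t))))).
  apply: measurable_minr => //; apply: measurable_funM; apply: measurable_funM.
  - exact: measurableT_comp.
  - apply: measurable_fun_invr; last exact: measurableT_comp.
    by move=> t; exact/ltW.
  - exact: measurable_theta_I.
  - apply: measurable_fun_invr; last exact: measurable_theta_I.
    by move=> t; have [h _] := hth t; case/andP: (h (I (y t))) => /ltW.
by apply/funext => t; rewrite alphaE.
Qed.

Let accept th x y := q x y * alpha lam pi I th x y.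

Let accept0 th x y : Theta th -> 0 <= accept th x y.
Proof. by move=> h; apply: mulr_ge0 => //; case/andP: (alpha_ge0_le1 x y h). Qed.

Let accept_le th x y : Theta th -> accept th x y <= q x y.
Proof.
move=> h; rewrite -[leRHS]mulr1; apply: ler_wpM2l => //.
by case/andP: (alpha_ge0_le1 x y h).
Qed.

Let mqx x : measurable_fun setT (q x).
Proof.
apply: (measurableT_comp mq (_ : measurable_fun setT (fun y => (x, y)))).
exact: measurable_pair1.
Qed.

Let maccept th x : Theta th -> measurable_fun setT (accept th x).
Proof.
move=> h; apply: measurable_funM => //.
by apply: (@measurable_alpha _ X (fun=> th) (fun=> x) id).
Qed.

Let cells_sum (f : X -> R) : measurable_fun setT f -> (forall y, 0 <= f y) ->
  (\int[lam]_y (f y)%:E = \sum_i \int[lam]_(y in cell I i) (f y)%:E)%E.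
Proof.
move=> mf f0.
rewrite -(@ge0_integral_bigsetU _ _ _ lam _ (cell I)) //=.
- congr integral; apply/seteqP; split=> // y _.
  by rewrite -bigcup_seq; exists (I y); rewrite /= ?mem_index_enum.
- exact: index_enum_uniq.
- by move=> i j _ _ [y [/= <- <-]].
- by apply/measurable_EFinP; apply: measurable_funTS.
- by move=> y _; rewrite lee_fin.
Qed.

(** [a] and [b] are the accepted and proposed masses, in the form taken by [mh_contraction]. The
    upper bound uses [pi y / pi x <= C / c]. For a stratum no heavier than the current one,
    acceptance is at least [c / C], the proposal density at least [cq], and the reference measure at
    least [theta_star / C]. *)
Lemma mh_kernel_cells (th : 'I_d -> R) x : Theta th ->
  exists a b : 'I_d -> R,
  [/\ forall i, mh_kernel lam pi I q th x (cell I i) =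
        (a i + (i == I x)%:R * (1 - \sum_l a l))%:E,
      forall i, 0 <= a i <= b i,
      \sum_i b i = 1,
      forall i, a i <= b i * (C / c * th (I x) / th i) &
      forall i, th i <= th (I x) -> cq * (c / C) / C * theta_star lam pi I i <= a i].
Proof.
move=> hth.
have th0 i : 0 < th i by case: hth => h _; case/andP: (h i).
have Cp := C0 x.
have fin_le (f : X -> R) i : measurable_fun setT f ->
    (forall y, 0 <= f y <= q x y) ->
    (\int[lam]_(y in cell I i) (f y)%:E)%E \is a fin_num.
  move=> mf hf; rewrite ge0_fin_numE; last first.
    by apply: integral_ge0 => y _; rewrite lee_fin; case/andP: (hf y).
  apply: (@le_lt_trans _ _ (\int[lam]_y (q x y)%:E)%E); last by rewrite q1 ltry.
  apply: (@le_trans _ _ (\int[lam]_(y in cell I i) (q x y)%:E)%E).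
    apply: ge0_le_integral => //.
    - by move=> y _; rewrite lee_fin; case/andP: (hf y).
    - by apply/measurable_EFinP; exact: measurable_funTS.
    - by apply/measurable_EFinP; exact: measurable_funTS.
    - by move=> y _; rewrite lee_fin; case/andP: (hf y).
  apply: ge0_subset_integral => //; first by apply/measurable_EFinP.
  by move=> y _; rewrite lee_fin.
have accq y : 0 <= accept th x y <= q x y by rewrite accept0//= accept_le.
have qq y : 0 <= q x y <= q x y by rewrite q0 /=.
pose a i := fine (\int[lam]_(y in cell I i) (accept th x y)%:E)%E.
pose b i := fine (\int[lam]_(y in cell I i) (q x y)%:E)%E.
have aE i : (\int[lam]_(y in cell I i) (accept th x y)%:E = (a i)%:E)%E.
  by rewrite fineK//; apply: fin_le => //; exact: maccept.
have bE i : (\int[lam]_(y in cell I i) (q x y)%:E = (b i)%:E)%E.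
  by rewrite fineK//; apply: fin_le.
exists a, b; split.
- move=> i; rewrite /mh_kernel -/(accept th x _).
  under eq_integral do rewrite -/(accept th x _).
  rewrite [X in (1 - X)%E](_ : _ = (\sum_l a l)%:E).
    by rewrite aE cell_indic eq_sym.
  rewrite -sumEFin cells_sum; [|exact: maccept|by move=> y; exact: accept0].
  by apply: eq_bigr => i' _; rewrite -aE.
- move=> i; rewrite -!lee_fin -aE -bE; apply/andP; split.
    by apply: integral_ge0 => y _; rewrite lee_fin accept0.
  apply: ge0_le_integral => //.
  + by move=> y _; rewrite lee_fin accept0.
  + by apply/measurable_EFinP; apply: measurable_funTS; exact: maccept.
  + by apply/measurable_EFinP; exact: measurable_funTS.
  + by move=> y _; rewrite lee_fin accept_le.
- apply: EFin_inj; rewrite -(q1 x) cells_sum// -sumEFin.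
  by apply: eq_bigr => i _; rewrite bE.
- move=> i; set D := C / c * th (I x) / th i.
  have D0 : 0 <= D by rewrite /D !mulr_ge0 ?invr_ge0// ltW.
  rewrite mulrC -lee_fin EFinM -aE -bE -ge0_integralZl_EFin//; first last.
  + by apply/measurable_EFinP; exact: measurable_funTS.
  + by move=> y _; rewrite lee_fin.
  apply: ge0_le_integral => //.
  + by move=> y _; rewrite lee_fin accept0.
  + by apply/measurable_EFinP; apply: measurable_funTS; exact: maccept.
  + apply/measurable_EFinP; apply: measurable_funTS.
    exact: measurable_funM.
  + move=> y yi; rewrite lee_fin /accept mulrC ler_wpM2r// alphaE// ge_min.
    apply/orP; right; rewrite (yi : I y = i) /D -[leRHS]mulrA ler_wpM2r//.
      by rewrite divr_ge0// ltW.
    by apply: ler_pM => //; rewrite ?invr_ge0 ?lef_pV2 ?posrE// ltW.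
- move=> i thi.
  have K0 : 0 <= cq * (c / C) / C by rewrite !mulr_ge0 ?invr_ge0// ltW.
  (* [fine] sends infinite values to [0], so positivity of [theta_star] forces the integral to be
     finite. *)
  have fts : (theta_star lam pi I i)%:E = (\int[lam]_(y in cell I i) (pi y)%:E)%E.
    rewrite /theta_star fineK// gt0_fin_numE.
      rewrite ltNge leye_eq; apply/negP => /eqP h.
      by have := theta_star0 i; rewrite /theta_star h /= ltxx.
    rewrite lt_neqAle integral_ge0 ?andbT; last by move=> y _; rewrite lee_fin ltW.
    apply/eqP => h; have := theta_star0 i; by rewrite /theta_star -h /= ltxx.
  rewrite -lee_fin EFinM fts -aE -ge0_integralZl_EFin//; first last.
  + by apply/measurable_EFinP; exact: measurable_funTS.
  + by move=> y _; rewrite lee_fin ltW.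
  apply: ge0_le_integral => //.
  + by move=> y _; rewrite lee_fin mulr_ge0// ltW.
  + apply/measurable_EFinP; apply: measurable_funTS.
    exact: measurable_funM.
  + by apply/measurable_EFinP; apply: measurable_funTS; exact: maccept.
  + move=> y yi; rewrite lee_fin /accept.
    have -> : cq * (c / C) / C * pi y = cq * (c / C * (pi y / C)) by ring.
    have cC : 0 <= c / C by rewrite divr_ge0// ltW.
    have pC : 0 <= pi y / C <= 1.
      apply/andP; split; first by rewrite divr_ge0// ltW.
      by rewrite ler_pdivrMr// mul1r.
    have cC1 : c / C <= 1.
      by rewrite ler_pdivrMr// mul1r; exact: le_trans (cpi x) (piC x).
    case/andP: pC => p0 p1.
    apply: ler_pM => //; [exact: ltW|exact: mulr_ge0|].
    have cCp : c / C * (pi y / C) <= c / C by rewrite -[leRHS]mulr1 ler_wpM2l.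
    rewrite alphaE// le_min (le_trans cCp cC1)/= (yi : I y = i).
    apply: (le_trans cCp).
    rewrite -[leLHS]mulr1; apply: ler_pM => //.
      by apply: ler_pM => //; rewrite ?invr_ge0 ?lef_pV2 ?posrE// ltW.
    by rewrite ler_pdivlMr// mul1r.
Qed.

(** Measurability of partial integrals in Tonelli's theorem, the domain of integration being moved
    into an indicator. *)
Lemma measurable_mh_kernel dT (T : measurableType dT) (th : T -> 'I_d -> R)
    (x : T -> X) i : sigma_finite setT lam ->
  (forall t, Theta (th t)) -> (forall j, measurable_fun setT (fun t => th t j)) ->
  measurable_fun setT x ->
  measurable_fun setT (fun t => mh_kernel lam pi I q (th t) (x t) (cell I i)).
Proof.
move=> sf hth mth mx.
(* Tonelli's theorem takes a bundled sigma-finite measure; [lam'] is [lam] packed with [sf]. *)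
have H1 := isSFinite.Build dX X R lam (sfinite_measure_sigma_finite sf).
have H2 := isSigmaFinite.Build dX X R lam sf.
pose lam' := HB.pack_for (SigmaFiniteMeasure.type X R) (Measure.sort lam) H1 H2.
have mint (A : set X) : measurable A -> measurable_fun setT
    (fun t => \int[lam]_(y in A) (q (x t) y * alpha lam pi I (th t) (x t) y)%:E)%E.
  move=> mA; pose f (z : T * X) : \bar R :=
    (q (x z.1) z.2 * alpha lam pi I (th z.1) (x z.1) z.2 * \1_A z.2)%:E.
  rewrite (_ : (fun t => _) = fubini_F lam' f).
    apply: measurable_fun_fubini_tonelli_F.
      have mx1 : measurable_fun setT (fun z : T * X => x z.1).
        exact: measurableT_comp.
      apply/measurable_EFinP; apply: measurable_funM.
        apply: measurable_funM.
          have mx2 : measurable_fun setT (fun z : T * X => (x z.1, z.2)).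
            exact: measurable_fun_pair.
          exact: (measurableT_comp mq mx2).
        by apply: measurable_alpha => // j; exact: (measurableT_comp (mth j)).
      exact: (measurableT_comp (measurable_indic mA)).
    move=> z; rewrite lee_fin; apply: mulr_ge0.
      exact: (accept0 (x z.1) z.2 (hth z.1)).
    by rewrite indicE.
  apply/funext => t; rewrite /fubini_F integral_mkcond; apply: eq_integral => y _.
  rewrite /f patchE indicE; case: (y \in A); first by rewrite mulr1.
  by rewrite mulr0.
apply: emeasurable_funD; first exact: mint.
apply: emeasurable_funM.
  apply/measurable_EFinP; exact: (measurableT_comp (measurable_indic (mcell i))).
by apply: emeasurable_funB => //; exact: mint.
Qed.

End Kernel.

(** * Conditioning through pi-systems *)

Section Density.
Import HBNNSimple.

(** Monotone approximation of [h] by simple functions, for which both sides are finite sums compared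
    through the hypothesis on [nu]. *)
Lemma ge0_integral_density d (T : measurableType d) (R : realType)
    (mu nu : {measure set T -> \bar R}) (k : T -> R) (h : T -> \bar R) :
  measurable_fun setT k -> (forall x, 0 <= k x) ->
  (forall A, measurable A -> nu A = \int[mu]_(x in A) (k x)%:E)%E ->
  measurable_fun setT h -> (forall x, 0 <= h x)%E ->
  (\int[nu]_x h x = \int[mu]_x (h x * (k x)%:E))%E.
Proof.
move=> mk k0 nuE mh h0.
have mkE : measurable_fun setT (EFin \o k) by exact/measurable_EFinP.
pose g := nnsfun_approx measurableT mh.
have mg n : measurable_fun setT (EFin \o g n) by exact/measurable_EFinP.
have cg x : (EFin \o g n) x @[n --> \oo] --> h x by exact: cvg_nnsfun_approx.
have ndg x : {homo (g ^~ x) : a b / (a <= b)%N >-> (a <= b)%R}.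
  by move=> a b ab; exact/lefP/nd_nnsfun_approx.
rewrite (nd_ge0_integral_lim nu h0 ndg cg).
have -> : (\int[mu]_x (h x * (k x)%:E) =
    lim (\int[mu]_x ((EFin \o g n) x * (k x)%:E) @[n --> \oo]))%E.
  have hk x : (h x * (k x)%:E = lim (((EFin \o g n) x * (k x)%:E) @[n --> \oo]))%E.
    by apply/esym/cvg_lim => //; exact: cvgeZr.
  under eq_integral => x _ do rewrite hk.
  apply: monotone_convergence => //.
  - by move=> n; exact: emeasurable_funM.
  - by move=> n x _ /=; rewrite mule_ge0 ?lee_fin.
  - by move=> x _ a b ab; apply: lee_wpmul2r; rewrite lee_fin//; exact: ndg.
congr (limn _); apply/funext => n /=; rewrite sintegralE.
have mI y : measurable (g n @^-1` [set y]) by exact: measurable_sfunP.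
transitivity (\int[mu]_x \sum_(y \in range (g n))
    (y%:E * ((\1_(g n @^-1` [set y]) x)%:E * (k x)%:E)))%E; last first.
  apply: eq_integral => x _; rewrite [in RHS]fimfunE -fsumEFin//.
  rewrite ge0_mule_fsuml => [|y]; last exact: nnfun_muleindic_ge0.
  by apply: eq_fsbigr => y _; rewrite EFinM muleA.
have mIk y : measurable_fun setT (fun x => (\1_(g n @^-1` [set y]) x)%:E * (k x)%:E)%E.
  by apply: emeasurable_funM => //; apply/measurable_EFinP; exact: measurable_indic.
rewrite ge0_integral_fsum//; first last.
- move=> y x _; rewrite muleA mule_ge0 ?lee_fin//; exact: nnfun_muleindic_ge0.
- by move=> y; exact: measurable_funeM.
apply: eq_fsbigr => _ /[!inE] -[x0 _ <-].
rewrite ge0_integralZl ?lee_fin//; last first.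
  by move=> x _; rewrite mule_ge0 ?lee_fin// indicE.
rewrite nuE// [in LHS]integral_mkcond; congr (_ * _)%E; apply: eq_integral => x _.
rewrite patchE indicE; case: (x \in _); first by rewrite mul1e.
by rewrite mul0e.
Qed.

(** Countable additivity of the integral; it lets uniqueness of measures be applied to densities. *)
Lemma density_measure d (T : measurableType d) (R : realType)
    (mu : {measure set T -> \bar R}) (k : T -> R) :
  measurable_fun setT k -> (forall x, 0 <= k x) ->
  exists nu : {measure set T -> \bar R},
    (forall A, measurable A -> nu A = \int[mu]_(x in A) (k x)%:E)%E.
Proof.
move=> mk k0.
pose f A := (\int[mu]_(x in A) (k x)%:E)%E.
have f0 : f set0 = 0%E by rewrite /f integral_set0.
have fge0 A : (0 <= f A)%E by apply: integral_ge0 => x _; rewrite lee_fin.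
have fadd : semi_sigma_additive f.
  move=> A mA tA mUA; rewrite /f ge0_integral_bigcup//.
  - apply: is_cvg_ereal_nneg_natsum_cond => n _ _; exact: fge0.
  - by apply: measurable_funTS; exact/measurable_EFinP.
  - by move=> x _; rewrite lee_fin.
have H := isMeasure.Build d T R f f0 fge0 fadd.
by exists (HB.pack_for (Measure.type T R) f H).
Qed.

End Density.

(* In terms of conditional expectations: [k1] and [k2] agree given [<<s G>>]. *)
Lemma pi_system_integral d (T : measurableType d) (R : realType)
    (mu : {measure set T -> \bar R}) (G : set (set T)) (k1 k2 : T -> R)
    (h : g_sigma_algebraType G -> \bar R) :
  setI_closed G -> G setT -> (forall A, G A -> measurable A) ->
  measurable_fun setT k1 -> (forall x, 0 <= k1 x) ->
  measurable_fun setT k2 -> (forall x, 0 <= k2 x) ->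
  (\int[mu]_x (k1 x)%:E < +oo)%E ->
  (forall A, G A -> \int[mu]_(x in A) (k1 x)%:E = \int[mu]_(x in A) (k2 x)%:E)%E ->
  measurable_fun setT h -> (forall x, 0 <= h x)%E ->
  (\int[mu]_x (h x * (k1 x)%:E) = \int[mu]_x (h x * (k2 x)%:E))%E.
Proof.
move=> GI GT Gm mk1 k10 mk2 k20 fink1 k12 mh h0.
have subG (A : set T) : <<s G >> A -> measurable A.
  by apply: smallest_sub; [exact: sigma_algebra_measurable|exact: Gm].
(* The identity, viewed as a map onto the smaller sigma-algebra. The density measures pushed along
   it agree on the pi-system [G] and have finite mass, hence coincide. *)
pose phi : T -> g_sigma_algebraType G := id.
have mphi : measurable_fun setT phi by move=> _ A mA; rewrite setTI; exact: subG.
have mh' : measurable_fun setT (h : T -> \bar R).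
  by move=> _ A mA; apply: subG; exact: mh.
have [nu1 nu1E] := density_measure mu mk1 k10.
have [nu2 nu2E] := density_measure mu mk2 k20.
rewrite -(ge0_integral_density mk1 k10 nu1E)// -(ge0_integral_density mk2 k20 nu2E)//.
have push (nu : {measure set T -> \bar R}) :
    (\int[nu]_x h x = \int[pushforward nu phi]_y h y)%E.
  by rewrite [RHS](ge0_integral_pushforward mphi).
rewrite (push nu1) (push nu2); apply: eq_measure_integral => A mA _.
apply: (@measure_unique _ R (g_sigma_algebraType G) G (fun=> setT) erefl) => //.
- by rewrite bigcup_const//; exists 0%N.
- by move=> B GB; rewrite /pushforward/= nu1E ?nu2E ?k12//; exact: Gm.
- by move=> n; apply: le_lt_trans fink1; rewrite -nu1E.
Qed.

Lemma limn_esup_le_bound (R : realType) (u : (\bar R)^nat) (r : \bar R) :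
  (forall n, (u n <= r)%E) -> (limn_esup u <= r)%E.
Proof.
move=> ur; apply: (@le_trans _ _ (ereal_sup (u @` setT))).
  by apply: ereal_inf_lbound; exists setT => //; exact: filterT.
by apply: ge_ereal_sup => _ [n _ <-].
Qed.

(** * The Wang-Landau process *)

Section Process.
Context (R : realType) (dX : measure_display) (X : measurableType dX) (d : nat).
Variables (lam : {measure set X -> \bar R}) (pi : X -> R) (I : X -> 'I_d).
Variables (q : X -> X -> R) (gamma : nat -> R).
Context (dO : measure_display) (Omega : measurableType dO).
Variables (P : probability Omega R).
Variables (Xs : nat -> Omega -> X) (th : nat -> Omega -> 'I_d -> R).
Hypothesis d2 : (2 <= d)%N.
Hypothesis sf : sigma_finite setT lam.
Hypothesis mpi : measurable_fun setT pi.
Hypothesis mcell : forall i, measurable (cell I i).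
Variables (c C cq : R).
Hypotheses (c0 : 0 < c) (cpi : forall x, c <= pi x) (piC : forall x, pi x <= C).
Hypothesis theta_star0 : forall i, 0 < theta_star lam pi I i.
Hypothesis mq : measurable_fun setT (fun z : X * X => q z.1 z.2).
Hypothesis q1 : forall x, (\int[lam]_y (q x y)%:E = 1)%E.
Hypotheses (cq0 : 0 < cq) (cqq : forall x y, cq <= q x y).
Hypothesis gamma01 : forall n, (1 <= n)%N -> 0 <= gamma n < 1.
Hypothesis gamma_dec : forall n, (1 <= n)%N -> gamma n.+1 <= gamma n.
Hypothesis gamma_lim : gamma @ \oo --> (0 : R).
Hypothesis wl : linearized_WL lam pi I q gamma P Xs th.

(** * The weight recursion and the filtration *)

Lemma th_update n w : th n.+1 w = wl_update (gamma n.+1) (th n w) (I (Xs n.+1 w)).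
Proof.
case: wl => _ _ _ H _; apply/funext => i.
by rewrite H /wl_update /Defs.H cell_indic.
Qed.

Lemma th_Theta n w : Theta (th n w).
Proof.
elim: n => [|n IH]; first by case: wl.
by rewrite th_update; apply: wl_update_Theta => //; exact: gamma01.
Qed.

Lemma th_gt0 n w i : 0 < th n w i.
Proof. by have [h _] := th_Theta n w; case/andP: (h i). Qed.

(* A pi-system generating the sigma-algebra F_n. *)
Definition history n : set (set Omega) :=
  [set E | exists (B : 'I_d -> set R) (A : nat -> set X),
    [/\ forall i, measurable (B i), forall k, measurable (A k) &
        E = [set w | (forall i, B i (th 0%N w i)) /\
                     (forall k, (k <= n)%N -> A k (Xs k w))]]].

Lemma history_setI n : setI_closed (history n).
Proof.
move=> _ _ [B [A [mB mA ->]]] [B' [A' [mB' mA' ->]]].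
exists (fun i => B i `&` B' i), (fun k => A k `&` A' k); split.
- by move=> i; exact: measurableI.
- by move=> k; exact: measurableI.
- apply/seteqP; split=> w /=.
    by move=> [[h1 h2] [h3 h4]]; split=> [i|k kn]; split; auto.
  move=> [h1 h2]; split; split.
  + by move=> i; case: (h1 i).
  + by move=> k kn; case: (h2 k kn).
  + by move=> i; case: (h1 i).
  + by move=> k kn; case: (h2 k kn).
Qed.

Lemma history_setT n : history n setT.
Proof. by exists (fun=> setT), (fun=> setT); split => //; apply/seteqP; split. Qed.

Lemma history_measurable n A : history n A -> measurable A.
Proof.
case: wl => mX mth0 _ _ _ [B [A' [mB mA ->]]].
rewrite (_ : [set w | _] = \bigcap_(i : 'I_d) ((fun w => th 0%N w i) @^-1` B i) `&`
   \bigcap_(k in [set k | (k <= n)%N]) (Xs k @^-1` A' k)); last first.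
  apply/seteqP; split=> w /= [h1 h2]; split.
  - by move=> i _; exact: h1.
  - by move=> k /=; exact: h2.
  - by move=> i; exact: h1.
  - by move=> k; exact: h2.
apply: measurableI.
  apply: fin_bigcap_measurable => // i _.
  by rewrite -[X in measurable X]setTI; exact: mth0.
apply: bigcap_measurableType => k _.
by rewrite -[X in measurable X]setTI; exact: mX.
Qed.

(** [Omega] equipped with F_n: measurability of a function with domain [hT n] is
    F_n-measurability. *)
Local Notation hT n := (g_sigma_algebraType (history n)).

Lemma hT_measurable n (A : set Omega) :
  measurable (A : set (hT n)) -> measurable A.
Proof.
have h : <<s history n >> `<=` measurable.
  apply: smallest_sub; [exact: sigma_algebra_measurable|].
  by move=> ?; exact: history_measurable.
exact: h.
Qed.

Lemma hT_measurable_fun n d' (T : measurableType d') (f : Omega -> T) :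
  measurable_fun setT (f : hT n -> T) -> measurable_fun setT f.
Proof. by move=> mf _ A mA; apply: (@hT_measurable n); exact: mf. Qed.

Lemma history_Xs n k : (k <= n)%N -> measurable_fun setT (Xs k : hT n -> X).
Proof.
move=> kn _ A mA; rewrite setTI; apply: sub_gen_smallest.
exists (fun=> setT), (fun l => if l == k then A else setT); split => //.
  by move=> l; case: ifP.
apply/seteqP; split=> w /=.
  by move=> Aw; split=> // l _; case: eqP => // ->.
by move=> [_ /(_ k kn)]; rewrite eqxx.
Qed.

Lemma history_th0 n i : measurable_fun setT ((fun w => th 0%N w i) : hT n -> R).
Proof.
move=> _ A mA; rewrite setTI; apply: sub_gen_smallest.
exists (fun l => if l == i then A else setT), (fun=> setT); split => //.
  by move=> l; case: ifP.
apply/seteqP; split=> w /=.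
  by move=> Aw; split=> // l; case: eqP => // ->.
by move=> [/(_ i)]; rewrite eqxx.
Qed.

(** The recursion makes each weight vector a measurable function of [th 0] and the points visited up
    to then. *)
Lemma history_th n k i : (k <= n)%N ->
  measurable_fun setT ((fun w => th k w i) : hT n -> R).
Proof.
elim: k i => [|k IH] i kn; first exact: history_th0.
rewrite (_ : (fun w => _) = fun w : hT n => th k w i + gamma k.+1 *
    (th k w i * (\1_(cell I i) (Xs k.+1 w) - th k w (I (Xs k.+1 w))))); last first.
  by case: wl => _ _ _ + _; move=> h; apply/funext => w; rewrite h.
have mk := fun i => IH i (ltnW kn); have mX := history_Xs kn.
apply: measurable_funD => //; apply: measurable_funM => //.
apply: measurable_funM => //; apply: measurable_funB.
  exact: measurableT_comp (measurable_indic (mcell i)) mX.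
exact: (@measurable_theta_I _ _ _ _ _ mcell _ (hT n) (th k) (Xs k.+1)).
Qed.

(** * Conditional law of the next stratum *)

Definition trans_prob n i w : R :=
  fine (mh_kernel lam pi I q (th n w) (Xs n w) (cell I i)).

Lemma trans_probP n w :
  exists a b : 'I_d -> R,
  [/\ forall i, trans_prob n i w = a i + (i == I (Xs n w))%:R * (1 - \sum_l a l),
      forall i, mh_kernel lam pi I q (th n w) (Xs n w) (cell I i) = (trans_prob n i w)%:E,
      forall i, 0 <= a i <= b i,
      \sum_i b i = 1 &
      [/\ forall i, a i <= b i * (C / c * th n w (I (Xs n w)) / th n w i) &
          forall i, th n w i <= th n w (I (Xs n w)) ->
                    cq * (c / C) / C * theta_star lam pi I i <= a i]].
Proof.
have [a [b [h1 h2 h3 h4 h5]]] := mh_kernel_cells mpi mcell c0 cpi piC theta_star0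
  mq q1 cq0 cqq (Xs n w) (th_Theta n w).
exists a, b; split => //.
- by move=> i; rewrite /trans_prob h1.
- by move=> i; rewrite /trans_prob h1.
Qed.

Lemma trans_prob_ge0 n i w : 0 <= trans_prob n i w.
Proof.
have [a [b [-> _ ab b1 _]]] := trans_probP n w.
have a1 : \sum_l a l <= 1.
  by rewrite -b1; apply: ler_sum => l _; case/andP: (ab l).
have /andP[a0 _] := ab i.
by rewrite addr_ge0// mulr_ge0// subr_ge0.
Qed.

Lemma measurable_trans_prob n i : measurable_fun setT (trans_prob n i).
Proof.
apply/measurable_EFinP.
rewrite (_ : EFin \o _ =
    fun w => mh_kernel lam pi I q (th n w) (Xs n w) (cell I i)).
  apply: (measurable_mh_kernel mpi mcell c0 cpi theta_star0 mq cq0 cqq) => //.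
  - by move=> w; exact: th_Theta.
  - move=> j; apply: (@hT_measurable_fun n _ _ (fun w => th n w j)).
    exact: history_th.
  - by case: wl.
by apply/funext => w /=; have [a [b [_ -> _ _ _]]] := trans_probP n w.
Qed.

(** [trans_prob n i] is the conditional probability, given F_n, that the next stratum is [i]. It is
    specified on generating events and extends to F_n-measurable test functions [h] by the pi-system
    argument. *)
Lemma integral_next_cell n i (h : Omega -> R) :
  measurable_fun setT (h : hT n -> R) -> (forall w, 0 <= h w) ->
  (\int[P]_w (h w * (I (Xs n.+1 w) == i)%:R)%:E =
   \int[P]_w (h w * trans_prob n i w)%:E)%E.
Proof.
move=> mh h0.
have mX : measurable_fun setT (Xs n.+1) by case: wl.
have mC : measurable (Xs n.+1 @^-1` cell I i).
  by rewrite -[X in measurable X]setTI; exact: mX.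
have kE w : (I (Xs n.+1 w) == i)%:R = \1_(Xs n.+1 @^-1` cell I i) w :> R.
  by rewrite -cell_indic !indicE; congr (nat_of_bool _)%:R;
    apply/idP/idP; rewrite !inE.
have mk : measurable_fun setT (fun w => (I (Xs n.+1 w) == i)%:R : R).
  by rewrite (funext kE); exact: measurable_indic.
under eq_integral do rewrite EFinM.
under [in RHS]eq_integral do rewrite EFinM.
apply: (@pi_system_integral _ Omega R P (history n)
  (fun w => (I (Xs n.+1 w) == i)%:R) (trans_prob n i) (EFin \o h)) => //.
- exact: history_setI.
- exact: history_setT.
- exact: history_measurable.
- exact: measurable_trans_prob.
- exact: trans_prob_ge0.
- under eq_integral do rewrite kE.
  rewrite integral_indic// setIT.
  by apply: le_lt_trans (probability_le1 P mC) _; exact: ltry.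
- move=> A hA; have mA := history_measurable hA.
  under eq_integral do rewrite kE.
  rewrite integral_indic// setIC.
  case: hA => B [A' [mB mA' ->]].
  case: wl => _ _ _ _ /(_ n B A' _ mB mA' (mcell i)) /= wlE.
  apply: (etrans wlE).
  apply: eq_integral => w _.
  by have [a [b [_ -> _ _ _]]] := trans_probP n w.
- exact/measurable_EFinP.
Qed.

(** * Choice of the constants *)

Lemma lyapunov_drift_small : exists s a eta : R, exists N : nat,
  [/\ 0 < s < 1, 0 <= a, 0 < eta, (1 <= N)%N &
   forall n w, (N <= n)%N -> (exists j, th n w j <= eta) ->
   \sum_i trans_prob n i w *
     lyapunov s a (gamma n.+1) (wl_update (gamma n.+1) (th n w) i) i <=
   lyapunov s a (gamma n) (th n w) (I (Xs n w))].
Proof.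
(* Any point of [X] yields [C > 0]. *)
pose x0 := Xs 0%N point.
have C0 : 0 < C by exact: lt_le_trans c0 (le_trans (cpi x0) (piC x0)).
have d0 : 0 < d%:R :> R by rewrite ltr0n ltnW.
pose K := cq * (c / C) / C.
have K0 : 0 < K by rewrite /K !mulr_gt0 ?invr_gt0.
pose tm := \big[Num.min/1]_i theta_star lam pi I i.
have tm0 : 0 < tm by apply: lt_bigmin.
(* Lower bound for the accepted mass of the lightest stratum. *)
pose eps := K * tm.
have eps0 : 0 < eps by exact: mulr_gt0.
have D0 : 0 < C / c by exact: divr_gt0.
(* Small enough that [(C / c) * s <= eps / 2], which leaves the contraction rate [kap = eps / 2];
   the cap [1/2] keeps [s < 1]. *)
pose s := Num.min (eps / (2 * (C / c))) 2^-1.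
have s0 : 0 < s by rewrite lt_min !divr_gt0 ?mulr_gt0//= invr_gt0.
have s1 : s < 1 by rewrite gt_min; apply/orP; right; lra.
have Ds : C / c * s <= eps / 2.
  apply: (@le_trans _ _ (C / c * (eps / (2 * (C / c))))).
    by apply: ler_wpM2l; [exact: ltW|rewrite ge_min lexx].
  by rewrite le_eqVlt; apply/orP; left; apply/eqP; field; rewrite !gt_eqF.
pose kap := eps / 2.
have kap0 : 0 < kap by exact: divr_gt0.
pose a := kap^-1.
have a0 : 0 <= a by rewrite invr_ge0 ltW.
have a1 : 0 <= 1 + a by lra.
have a7 : 0 < 2 + 7 * a by lra.
pose del := eps / (2 * d%:R).
have del0 : 0 < del by rewrite divr_gt0// mulr_gt0.
(* Solves [(1 + a) * eta^s = eps / (2 * d)], the largest additive error [lyapunov_drift]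
   tolerates. *)
pose eta := (del / (1 + a)) `^ s^-1.
have eta0 : 0 < eta by rewrite powR_gt0// divr_gt0//; lra.
have etaE : (1 + a) * eta `^ s = del.
  have a1' : 0 < 1 + a by lra.
  have dv : 0 <= del / (1 + a) by rewrite divr_ge0// ltW.
  rewrite /eta -powRrM mulVf ?gt_eqF// powRr1//.
  by rewrite mulrC divfK// gt_eqF.
pose g := Num.min 2^-1 (del / (2 + 7 * a)).
have g0 : 0 < g by rewrite lt_min invr_gt0 ltr0n/= divr_gt0//; lra.
have /cvgrPdist_le /(_ g g0) [N _ HN] := gamma_lim.
(* The maximum with [1] is there because the step sizes are constrained only from index [1] on. *)
exists s, a, eta, (maxn 1 N)%N; split => //; first by rewrite s0.
  by rewrite leq_maxl.
move=> n w; rewrite geq_max => /andP[n1 Nn] [j0 hj0].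
have /andP[gn0 _] := gamma01 (leqW n1).
have gng : gamma n.+1 <= g.
  have /= := HN n.+1 (leqW Nn); rewrite sub0r normrN; exact: le_trans (ler_norm _).
have [a' [b [kE _ ab b1 [aD aeps]]]] := trans_probP n w.
have [i0 _ i0min] := @Order.TotalTheory.arg_minP _ _ _ (I (Xs n w)) xpredT (th n w) isT.
have epsa : eps <= a' i0.
  apply: le_trans (aeps i0 (i0min _ isT)).
  by rewrite /eps -/K ler_pM2l//; exact: bigmin_le_cond.
apply: (@lyapunov_drift _ _ s kap eps (gamma n.+1) (gamma n) (th n w)
  (fun i => trans_prob n i w) i0 (I (Xs n w))) => //.
- by rewrite s0.
- by rewrite gn0 (le_trans gng)// ge_min lexx.
- exact: gamma_dec.
- exact: th_Theta.
- by move=> i; exact: trans_prob_ge0.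
- rewrite (eq_bigr _ (fun i _ => kE i)) big_split/= -mulr_suml.
  rewrite [X in _ + X * _](bigD1 (I (Xs n w)))//= eqxx [X in _ + (_ + X) * _]big1.
    by rewrite addr0 mul1r; ring.
  by move=> i /negbTE ->.
- by move=> i; exact: i0min.
- rewrite kE -[leLHS]addr0 lerD// mulr_ge0// subr_ge0 -b1.
  by apply: ler_sum => l _; case/andP: (ab l).
- rewrite (eq_bigr (fun i => (a' i + (i == I (Xs n w))%:R * (1 - \sum_l a' l)) *
    th n w i `^ s)); last by move=> i _; rewrite kE.
  apply: (le_trans (@mh_contraction _ _ a' b (th n w) (C / c) eps s i0 _ _ _ ab b1 aD _ epsa _)).
  + by move=> i; exact: th_gt0.
  + by move=> i; exact: i0min.
  + exact: ltW.
  + by rewrite s0.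
  rewrite lerD2r ler_wpM2r ?powR_ge0//; rewrite /kap; lra.
- apply: (@le_trans _ _ ((2 + 7 * a) * (del / (2 + 7 * a)))).
    apply: ler_wpM2l; first exact: ltW a7.
    by rewrite (le_trans gng)// ge_min lexx orbT.
  by rewrite mulrC divfK// gt_eqF.
- rewrite -/del -etaE; apply: ler_wpM2l; first exact: a1.
  apply: ge0_ler_powR; [exact: ltW| | |exact: le_trans (i0min j0 isT) hj0].
    by rewrite nnegrE; exact/ltW/th_gt0.
  by rewrite nnegrE; exact: ltW.
Qed.

(** * The integrated drift inequality *)

(** [u] stands for the weight of the occupied stratum, which may be random or fixed. *)
Lemma measurable_lyapunov d' (T : measurableType d') (s a g : R)
    (f : T -> 'I_d -> R) (u : T -> R) :
  (forall i, measurable_fun setT (fun t => f t i)) -> (forall t i, 0 < f t i) ->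
  measurable_fun setT u ->
  measurable_fun setT (fun t => sum_inv (f t) * (1 + a * g * u t `^ s)).
Proof.
move=> mf f0 mu; apply: measurable_funM.
  apply: measurable_sum => i; apply: measurable_fun_invr => // t.
  exact/ltW/f0.
apply: measurable_funD => //; apply: measurable_funM => //.
exact: (measurableT_comp (measurable_powR s) mu).
Qed.

Lemma lyapunov_ge0 (s a g : R) (f : 'I_d -> R) i :
  (forall j, 0 < f j) -> 0 <= a -> 0 <= g -> 0 <= lyapunov s a g f i.
Proof.
move=> f0 a0 g0; apply: mulr_ge0; first exact/ltW/(sum_inv_gt0 i f0).
by rewrite addr_ge0// !mulr_ge0// powR_ge0.
Qed.

Lemma history_lyapunov s a n :
  measurable_fun setT ((fun w => lyapunov s a (gamma n) (th n w) (I (Xs n w))) :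
    hT n -> R).
Proof.
apply: (@measurable_lyapunov _ (hT n)).
- by move=> i; exact: history_th.
- by move=> w i; exact: th_gt0.
- apply: (@measurable_theta_I _ _ _ _ _ mcell _ (hT n) (th n) (Xs n)).
    by move=> i; exact: history_th.
  exact: history_Xs.
Qed.

Lemma history_next_lyapunov s a n i :
  measurable_fun setT ((fun w =>
    lyapunov s a (gamma n.+1) (wl_update (gamma n.+1) (th n w) i) i) : hT n -> R).
Proof.
have mup j : measurable_fun setT
    ((fun w => wl_update (gamma n.+1) (th n w) i j) : hT n -> R).
  have mt l : measurable_fun setT ((fun w => th n w l) : hT n -> R).
    exact: history_th.
  apply: measurable_funD => //; apply: measurable_funM => //.
  by apply: measurable_funM => //; apply: measurable_funB.
apply: (@measurable_lyapunov _ (hT n)) => // w j.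
have [h _] := wl_update_Theta i (gamma01 (ltn0Sn n)) d2 (th_Theta n w).
by case/andP: (h j).
Qed.

(** Split according to the next stratum [i]: for fixed [i] the next value is F_n-measurable, so the
    indicator of [i] may be replaced by its conditional probability. The pointwise drift on [A] then
    applies. *)
Lemma integral_lyapunov_step s a n (A : set Omega) : 0 <= a -> (1 <= n)%N ->
  measurable (A : set (hT n)) ->
  (forall w, A w -> \sum_i trans_prob n i w *
     lyapunov s a (gamma n.+1) (wl_update (gamma n.+1) (th n w) i) i <=
   lyapunov s a (gamma n) (th n w) (I (Xs n w))) ->
  (\int[P]_w (\1_A w * lyapunov s a (gamma n.+1) (th n.+1 w) (I (Xs n.+1 w)))%:E <=
   \int[P]_w (\1_A w * lyapunov s a (gamma n) (th n w) (I (Xs n w)))%:E)%E.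
Proof.
move=> a0 n1 mA drift.
pose nxt i w := lyapunov s a (gamma n.+1) (wl_update (gamma n.+1) (th n w) i) i.
have /andP[g1 _] := gamma01 (ltn0Sn n).
have nxt0 i w : 0 <= nxt i w.
  apply: lyapunov_ge0 => // j.
  have [h _] := wl_update_Theta i (gamma01 (ltn0Sn n)) d2 (th_Theta n w).
  by case/andP: (h j).
have A0 w : 0 <= \1_A w :> R by rewrite indicE.
have mAn i : measurable_fun setT ((fun w => \1_A w * nxt i w) : hT n -> R).
  apply: measurable_funM; first exact: (@measurable_indic _ (hT n)).
  exact: history_next_lyapunov.
have mA0 i w : 0 <= \1_A w * nxt i w by rewrite mulr_ge0.
have mAnO i := hT_measurable_fun (mAn i).
have mX : measurable_fun setT (Xs n.+1) by case: wl.
have mI i : measurable_fun setT (fun w => (I (Xs n.+1 w) == i)%:R : R).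
  under eq_fun do rewrite -cell_indic.
  exact: measurableT_comp (measurable_indic (mcell i)) mX.
have mt i := measurable_trans_prob n i.
rewrite (eq_integral (fun w =>
    \sum_i (\1_A w * nxt i w * (I (Xs n.+1 w) == i)%:R)%:E)%E); last first.
  move=> w _; rewrite sumEFin; congr EFin.
  rewrite (bigD1 (I (Xs n.+1 w)))//= eqxx mulr1 big1 ?addr0.
    by rewrite th_update.
  by move=> i; rewrite eq_sym => /negbTE ->; rewrite mulr0.
rewrite ge0_integral_sum//; last 2 first.
- by move=> i; apply/measurable_EFinP; exact: measurable_funM.
- by move=> i w _; rewrite lee_fin; apply: mulr_ge0 => //; exact: mA0.
rewrite (eq_bigr _ (fun i _ => integral_next_cell i (mAn i) (mA0 i))).
rewrite -ge0_integral_sum//; last 2 first.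
- by move=> i; apply/measurable_EFinP; exact: measurable_funM.
- by move=> i w _; rewrite lee_fin; apply: mulr_ge0; [exact: mA0|exact: trans_prob_ge0].
apply: ge0_le_integral => //.
- move=> w _; apply: sume_ge0 => i _.
  by rewrite lee_fin; apply: mulr_ge0; [exact: mA0|exact: trans_prob_ge0].
- by apply: emeasurable_sum => i; apply/measurable_EFinP; exact: measurable_funM.
- apply/measurable_EFinP; apply: (@hT_measurable_fun n).
  apply: measurable_funM; first exact: (@measurable_indic _ (hT n)).
  exact: history_lyapunov.
- move=> w _; rewrite sumEFin lee_fin.
  under eq_bigr do rewrite -mulrA (mulrC (nxt _ w)).
  rewrite -mulr_sumr indicE; case: (boolP (w \in A)) => [|_]; last by rewrite !mul0r.
  by rewrite inE !mul1r; exact: drift.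
Qed.

Lemma measurable_small_th n k eta : (k <= n)%N ->
  measurable ([set w | exists j, th k w j <= eta] : set (hT n)).
Proof.
move=> kn.
rewrite (_ : [set w | _] = \bigcup_(j : 'I_d) [set w : hT n | th k w j <= eta]).
  apply: fin_bigcup_measurable => // j _.
  rewrite -[X in measurable X]setTI.
  exact: (measurable_fun_le measurableT (history_th j kn) (measurable_cst eta)).
by apply/seteqP; split=> [w [j hj]|w [j _ hj]]; exists j.
Qed.

(** * Trajectories whose smallest weight stays small *)

Section Trap.
Variables (s a eta M : R) (m : nat).
Hypotheses (s01 : 0 < s < 1) (a0 : 0 <= a) (M0 : 0 <= M) (m1 : (1 <= m)%N).
Hypothesis drift : forall n w, (m <= n)%N -> (exists j, th n w j <= eta) ->
   \sum_i trans_prob n i w *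
     lyapunov s a (gamma n.+1) (wl_update (gamma n.+1) (th n w) i) i <=
   lyapunov s a (gamma n) (th n w) (I (Xs n w)).

Let W n w := lyapunov s a (gamma n) (th n w) (I (Xs n w)).

(** Cut off at time [n] so that the event lies in F_n; the bound at time [m] makes the initial
    expectation finite. *)
Let trap n := [set w | sum_inv (th m w) <= M /\
  forall k, (m <= k <= n)%N -> exists j, th k w j <= eta].

Let mtrap n : (m <= n)%N -> measurable (trap n : set (hT n)).
Proof.
move=> mn.
rewrite (_ : trap n = [set w : hT n | sum_inv (th m w) <= M] `&`
    \bigcap_(k in [set k | (m <= k <= n)%N])
      [set w : hT n | exists j, th k w j <= eta]); last first.
  by apply/seteqP; split.
apply: measurableI.
  rewrite -[X in measurable X]setTI.
  apply: (measurable_fun_le measurableT _ (measurable_cst M)).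
  apply: measurable_sum => i; apply: (@measurable_fun_invr _ (hT n)).
    by move=> w; exact/ltW/th_gt0.
  exact: history_th.
apply: bigcap_measurableType => k /= /andP[_ kn].
exact: measurable_small_th.
Qed.

Let W0 n w : (m <= n)%N -> 0 <= W n w.
Proof.
move=> mn; apply: lyapunov_ge0 => //; first by move=> j; exact: th_gt0.
by have /andP[] := gamma01 (leq_trans m1 mn).
Qed.

Let indic_leS n w : (\1_(trap n.+1) w : R) <= \1_(trap n) w.
Proof.
rewrite !indicE; case: (boolP (w \in trap n.+1)) => [|_]; last by rewrite ler0n.
rewrite inE => -[h1 h2]; rewrite mem_set//; split => // k /andP[mk kn].
by apply: h2; rewrite mk leqW.
Qed.

Let mindW n k : (m <= n)%N -> measurable_fun setT (fun w => (\1_(trap n) w : R) * W k w).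
Proof.
move=> mn; apply: measurable_funM.
  by apply: measurable_indic; apply: (@hT_measurable n); exact: mtrap.
by apply: (@hT_measurable_fun k); exact: history_lyapunov.
Qed.

(** Supermartingale bound restricted to the trap. At time [m] the corrector is at most [1 + a], the
    step and the weight being at most [1]. *)
Let integral_trap_bound l :
  (\int[P]_w (\1_(trap (m + l)) w * W (m + l) w)%:E <= (M * (1 + a))%:E)%E.
Proof.
elim: l => [|l IH].
  rewrite addn0.
  apply: (@le_trans _ _ (\int[P]_w cst (M * (1 + a))%:E w)%E); last first.
    rewrite integral_cst// -[leRHS]mule1 le_eqVlt; apply/orP; left; apply/eqP.
    by congr (_ * _)%E; exact: probability_setT.
  have Ma : 0 <= M * (1 + a) by rewrite mulr_ge0// addr_ge0.
  apply: ge0_le_integral => //.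
  - by move=> w _; rewrite lee_fin mulr_ge0 ?indicE// W0.
  - by apply/measurable_EFinP; exact: mindW.
  - move=> w _; rewrite lee_fin indicE; case: (boolP (w \in trap m)) => [|_].
      rewrite inE mul1r => -[hM _]; rewrite /W /lyapunov.
      have F0 : 0 <= sum_inv (th m w).
        exact/ltW/(sum_inv_gt0 (I (Xs m w)))/th_gt0.
      have /andP[g0 /ltW g1] := gamma01 m1.
      set t := th m w (I (Xs m w)).
      have ts1 : t `^ s <= 1.
        have [h _] := th_Theta m w; have /andP[t0 /ltW t1] := h (I (Xs m w)).
        rewrite -(powRr0 t); apply: ger_powR; first by rewrite t0.
        by case/andP: s01 => /ltW.
      apply: ler_pM => //.
        by rewrite addr_ge0// !mulr_ge0// powR_ge0.
      rewrite lerD2l -[leRHS]mulr1 -mulrA ler_wpM2l//.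
      by rewrite -[leRHS]mulr1 ler_pM// powR_ge0.
    by rewrite mul0r.
(* The event is first enlarged to the trap one step earlier, which is measurable for the past as the
   drift step requires. *)
rewrite addnS; apply: le_trans IH.
apply: (@le_trans _ _ (\int[P]_w (\1_(trap (m + l)) w * W (m + l).+1 w)%:E)%E).
  apply: ge0_le_integral => //.
  - by move=> w _; rewrite lee_fin mulr_ge0 ?indicE// W0// leqW// leq_addr.
  - by apply/measurable_EFinP; apply: mindW; rewrite leqW// leq_addr.
  - by apply/measurable_EFinP; apply: mindW; rewrite leq_addr.
  - by move=> w _; rewrite lee_fin ler_wpM2r// W0// leqW// leq_addr.
apply: integral_lyapunov_step => //.
- by rewrite (leq_trans m1)// leq_addr.
- by apply: mtrap; rewrite leq_addr.
- move=> w [_ h]; apply: drift; first exact: leq_addr.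
  by apply: h; rewrite leq_addr leqnn.
Qed.


(** By Fatou, the integral over [B] of the lower limit of W_n is at most [M * (1 + a)], whereas W_n
    dominates [sum_inv] and so tends to infinity on [B]. *)
Lemma trap_null (B : set Omega) : measurable B ->
  (forall w, B w -> sum_inv (th m w) <= M) ->
  (forall w, B w -> forall k, (m <= k)%N -> exists j, th k w j <= eta) ->
  (forall w, B w -> forall K, \forall n \near \oo, K <= sum_inv (th n w)) ->
  P B = 0%E.
Proof.
move=> mB BM Beta Boo.
have trapB w l : B w -> trap (m + l) w.
  move=> Bw; split; first exact: BM.
  by move=> k /andP[mk _]; exact: Beta.
pose f l w := (W (m + l) w)%:E.
have mf l : measurable_fun setT (f l).
  apply/measurable_EFinP; apply: (@hT_measurable_fun (m + l)%N).
  exact: history_lyapunov.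
have fint l : (\int[P]_(w in B) f l w <= (M * (1 + a))%:E)%E.
  apply: le_trans (integral_trap_bound l).
  rewrite (eq_integral (fun w => (\1_(trap (m + l)) w * W (m + l) w)%:E)); last first.
    by move=> w; rewrite inE => Bw; rewrite indicE mem_set ?mul1r//; exact: trapB.
  apply: ge0_subset_integral => //.
    by apply/measurable_EFinP; apply: mindW; rewrite leq_addr.
  by move=> w _; rewrite lee_fin mulr_ge0 ?indicE// W0// leq_addr.
have finf : (\int[P]_(w in B) limn_einf (f^~ w) <= (M * (1 + a))%:E)%E.
  apply: (@le_trans _ _ (limn_einf (fun l => \int[P]_(w in B) f l w)))%E.
    apply: fatou => // [l|l w _]; first exact: measurable_funTS.
    by rewrite lee_fin W0// leq_addr.
  apply: (le_trans (limn_einf_sup _)); exact: limn_esup_le_bound.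
have liminfB w : B w -> limn_einf (f^~ w) = +oo%E.
  move=> Bw; apply: (cvg_limn_einf_sup _).1; apply/cvgeyPge => K.
  have [n0 _ Hn0] := Boo w Bw K.
  exists n0 => // n /= n0n; rewrite lee_fin.
  have mn : (n0 <= m + n)%N by rewrite (leq_trans n0n)// leq_addl.
  apply: le_trans (Hn0 _ mn) _; rewrite /W /lyapunov ler_peMr//.
    exact/ltW/(sum_inv_gt0 (I (Xs 0%N w)))/th_gt0.
  have mn1 : (1 <= m + n)%N by rewrite (leq_trans m1)// leq_addr.
  have /andP[g0 _] := gamma01 mn1.
  by rewrite lerDl !mulr_ge0// powR_ge0.
move: finf; rewrite (eq_integral (cst +oo%E)); last first.
  by move=> w; rewrite inE => Bw; rewrite liminfB.
rewrite integral_cst// => finf; apply/eqP; rewrite eq_le measure_ge0 andbT leNgt.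
by apply/negP => PB; move: finf; rewrite gt0_mulye.
Qed.

End Trap.

(** * From null traps to the almost sure statement *)

(** Off the event the smallest weight tends to zero, so the trajectory is eventually trapped with
    [sum_inv] unbounded. Countably many null traps, indexed by starting time and initial bound,
    cover this case. *)
Lemma limsup_min_th_gt0 :
  P [set w | (0 < limn_esup
       (fun n => \big[Order.min/+oo]_(j < d) (th n w j)%:E))%E] = 1%E.
Proof.
pose v n w : \bar R := \big[Order.min/+oo%E]_(j < d) (th n w j)%:E.
have mth n j : measurable_fun setT (fun w => th n w j).
  by apply: (@hT_measurable_fun n _ _ (fun w => th n w j)); exact: history_th.
have mv n : measurable_fun setT (v n).
  rewrite /v; elim: (index_enum _) => [|j r IH].
    by under eq_fun do rewrite big_nil; exact: measurable_cst.
  under eq_fun do rewrite big_cons.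
  by apply: measurable_mine => //; exact/measurable_EFinP.
pose S := [set w | (0 < limn_esup (v^~ w))%E].
have mS : measurable S.
  rewrite -[X in measurable X]setTI.
  exact: (emeasurable_fun_o_infty measurableT (measurable_fun_limn_esup mv)).
suff null : P (~` S) = 0%E.
  have := probability_setC P (measurableC mS).
  by rewrite setCK null sube0.
have small w : (~` S) w -> forall e, 0 < e -> \forall n \near \oo, exists j, th n w j < e.
  move=> /negP; rewrite -leNgt => hw e e0.
  have : (limn_esup (v^~ w) < e%:E)%E by apply: le_lt_trans hw _; rewrite lte_fin.
  move=> /ereal_inf_lt[_ [V Voo <-] supV]; apply: filterS Voo => n Vn.
  have vn : (v n w < e%:E)%E.
    by apply: le_lt_trans supV; apply: ereal_sup_ubound; exists n.
  apply: contrapT => /forallNP hn; move: vn; rewrite ltNge => /negP; apply.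
  (* If no weight is below [e], neither is the minimum, its neutral element being infinite. *)
  rewrite /v; elim/big_ind: _ => [|x y ex ey|j _]; first exact: leey.
    by rewrite le_min ex.
  by rewrite lee_fin leNgt; apply/negP; exact: hn.
have [s [a [eta [N [s01 a0 eta0 N1 drift]]]]] := lyapunov_drift_small.
pose B m M := ~` S `&` [set w | sum_inv (th (N + m)%N w) <= M%:R] `&`
  \bigcap_(k in [set k | (N + m <= k)%N]) [set w | exists j, th k w j <= eta].
have mB m M : measurable (B m M).
  apply: measurableI.
    apply: measurableI; first exact: measurableC.
    rewrite -[X in measurable X]setTI.
    apply: (measurable_fun_le measurableT _ (measurable_cst _)).
    apply: measurable_sum => i; apply: measurable_fun_invr => // w.
    exact/ltW/th_gt0.
  apply: bigcap_measurableType => k _; apply: (@hT_measurable k).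
  exact: measurable_small_th.
have B0 m M : P (B m M) = 0%E.
  apply: (@trap_null s a eta M%:R (N + m)%N) => //.
  - by rewrite (leq_trans N1)// leq_addr.
  - by move=> n w mn; apply: drift; rewrite (leq_trans _ mn)// leq_addr.
  - by move=> w [[]].
  - by move=> w [_ h] k; exact: h.
  - move=> w [[Sw _] _] K.
    (* A weight below [1 / (|K| + 1)] already makes [sum_inv] exceed [K]. *)
    have K1 : 0 < `|K| + 1 by rewrite ltr_pwDr.
    apply: filterS (small w Sw (`|K| + 1)^-1 _); last by rewrite invr_gt0.
    move=> n [j hj]; apply: le_trans (sum_inv_ge j (th_gt0 n w)).
    apply: (@le_trans _ _ (`|K| + 1)).
      by rewrite (le_trans (ler_norm K))// lerDl.
    by rewrite -[leLHS]invrK lef_pV2 ?posrE ?invr_gt0 ?th_gt0// ltW.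
apply/(negligibleP P (measurableC mS)).
apply: (@negligibleS _ _ _ _ (\bigcup_m \bigcup_M B m M)).
  move=> w Sw; have [n0 _ Hn0] := small w Sw eta eta0.
  (* The trap starts at [N + n0], when the drift bound holds and the weights are already small; the
     integer above [sum_inv] at that time is the bound. *)
  exists n0 => //; exists (Num.truncn (sum_inv (th (N + n0)%N w))).+1 => //.
  split; first by split => //=; exact/ltW/truncnS_gt.
  move=> k /= Nk; have [|j hj] := Hn0 k; last by exists j; exact: ltW.
  by rewrite /= (leq_trans _ Nk)// leq_addl.
apply: negligible_bigcup => m; apply: negligible_bigcup => M.
apply/(negligibleP P (mB m M)); exact: B0.
Qed.

End Process.

Theorem theorem1 (R : realType) (dX : measure_display) (X : measurableType dX)
  (d : nat) (lam : {measure set X -> \bar R}) (pi : X -> R) (I : X -> 'I_d)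
  (q : X -> X -> R) (gamma : nat -> R)
  (dO : measure_display) (Omega : measurableType dO) (P : probability Omega R)
  (Xs : nat -> Omega -> X) (th : nat -> Omega -> 'I_d -> R) :
  (* standing assumptions *)
  @polish_borel R dX X ->
  (2 <= d)%N ->
  sigma_finite setT lam ->
  measurable_fun setT pi ->
  (forall x, 0 <= pi x) ->
  (\int[lam]_x (pi x)%:E = 1)%E ->
  (forall i, measurable (cell I i)) ->
  (* (A1) *)
  (exists2 c, 0 < c & forall x, c <= pi x) ->
  (exists C, forall x, pi x <= C) ->
  (forall i, 0 < theta_star lam pi I i) ->
  (* (A2): symmetric proposal density q w.r.t. lam with inf q > 0 *)
  measurable_fun setT (fun z : X * X => q z.1 z.2) ->
  (forall x, (\int[lam]_y (q x y)%:E = 1)%E) ->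
  (forall x y, q x y = q y x) ->
  (exists2 c, 0 < c & forall x y, c <= q x y) ->
  (* step sizes *)
  (forall n, (1 <= n)%N -> 0 <= gamma n < 1) ->
  (forall n, (1 <= n)%N -> gamma n.+1 <= gamma n) ->
  gamma @ \oo --> 0 ->
  (* the linearized Wang--Landau algorithm *)
  linearized_WL lam pi I q gamma P Xs th ->
  P [set w | (0 < limn_esup
       (fun n => \big[Order.min/+oo]_(j < d) (th n w j)%:E))%E] = 1%E.
Proof.
move=> _ d2 sf mpi _ _ mcell [c c0 cpi] [C piC] ts0 mq q1 _ [cq cq0 cqq] g01 gdec glim wl.
exact: (@limsup_min_th_gt0 R dX X d lam pi I q gamma dO Omega P Xs th d2 sf mpi
  mcell c C cq c0 cpi piC ts0 mq q1 cq0 cqq g01 gdec glim wl).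
Qed.
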